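(* Let $\mathcal{T}$ be a convex theory with signature $\Pi = (\Sigma_0 \cup \Sigma_1, \mathsf{Pred})$, where the function symbols in $\Sigma_0$ are interpreted and those in $\Sigma_1$ are uninterpreted, let $C$ be a set of constants, and let $\Sigma_S \subseteq \Sigma_1 \cup C$. Let $\mathcal{T}'$ be the primed copy of $\mathcal{T}$ with respect to $\Sigma_S$ (defined in the context). (i) If $\mathcal{T} \cup \mathcal{T}'$ has the $\approx$-interpolation property with intersection-sharing, then $\mathcal{T}$ has the $\Sigma_S$-Beth definability property. (ii) Assume moreover that $\mathcal{T} = \mathcal{T}_0 \cup \mathcal{K}$, where all symbols in the signature of $\mathcal{T}_0$ are regarded as interpreted and $\mathcal{K}$ is a set of clauses also containing the uninterpreted function symbols in $\Sigma_1$; then $\mathcal{T}' = \mathcal{T}_0 \cup \mathcal{K}'$ where $\mathcal{K}'$ is the primed copy of $\mathcal{K}$. If $\mathcal{T} \cup \mathcal{T}'$ has the $\approx$-interpolation property with $\Theta_{\mathcal{K} \cup \mathcal{K}'}$-sharing, then $\mathcal{T}$ has the $\Theta_{\mathcal{K}}(\Sigma_S)$-Beth definability property.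
   Context: Convexity: $\mathcal{T}$ is convex if whenever a conjunction $\Gamma$ of ground atoms (possibly with additional constants) entails w.r.t. $\mathcal{T}$ a disjunction $\bigvee_{i=1}^m R_i(\overline{t}_i)$ of ground atoms with $R_i \in \mathsf{Pred} \cup \{\approx\}$, it entails some single disjunct. Primed copies: let $\Sigma_r = \Sigma_1 \setminus \Sigma_S$ and $\Sigma'_r = \{ f' \mid f \in \Sigma_r\}$ be new primed copies. For a $\Pi^C$-formula $\phi$, $\phi'$ is obtained from $\phi$ by replacing every function symbol in $\Sigma_1 \setminus \Sigma_S$ and every constant in $C \setminus \Sigma_S$ by its distinct primed copy (symbols of $\Sigma_0$, $\mathsf{Pred}$ and $\Sigma_S$ are unchanged). $\mathcal{T}' = \{\phi' \mid \phi \in \mathcal{T}\}$. In $\mathcal{T} \cup \mathcal{T}'$ the symbols of $\Sigma_0$ are interpreted and those of $\Sigma_1 \cup \Sigma'_r$ uninterpreted. $\approx$-interpolation with a sharing notion: a theory has it if for all conjunctions of ground atoms $A(\overline{c}, \overline{a}_1, a)$ and $B(\overline{c}, \overline{b}_1, b)$ (where $\overline{c}$ are the constants common to $A$ and $B$, $a$ occurs in $A$, $b$ occurs in $B$) with $A \wedge B \models a \approx b$ (w.r.t. the theory), there exists a term $t(\overline{c})$ containing only the common constants $\overline{c}$, interpreted function symbols, and uninterpreted function symbols that are ''shared'' by $A$ and $B$, such that $A \wedge B \models a \approx t(\overline{c}) \wedge t(\overline{c}) \approx b$. If $\Sigma_A, \Sigma_B$ are the uninterpreted function symbols occurring in $A$,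 $B$: intersection-sharing means the shared symbols are $\Sigma_A \cap \Sigma_B$; $\Theta$-sharing for a closure operator $\Theta$ means the shared symbols are $\Theta(\Sigma_A) \cap \Theta(\Sigma_B)$. $\Theta_{\mathcal{K}}$: for uninterpreted $f, g$ put $f \sim_{\mathcal{K}} g$ iff some clause of $\mathcal{K}$ contains both $f$ and $g$; let $\sim^*_{\mathcal{K}}$ be the equivalence relation generated by $\sim_{\mathcal{K}}$ on $\Sigma_1$, and $\Theta_{\mathcal{K}}(\Sigma) = \bigcup_{f \in \Sigma}\{ g \in \Sigma_1 \mid f \sim^*_{\mathcal{K}} g\}$ for $\Sigma \subseteq \Sigma_1$; for $\Sigma_S \subseteq \Sigma_1 \cup C$ we take $\Theta_{\mathcal{K}}(\Sigma_S) = (\Sigma_S \cap C) \cup \Theta_{\mathcal{K}}(\Sigma_S \cap \Sigma_1)$. $\Theta_{\mathcal{K} \cup \mathcal{K}'}$ is defined analogously on $\Sigma_1 \cup \Sigma'_r$ using the clauses of $\mathcal{K} \cup \mathcal{K}'$. Beth definability w.r.t. $\Sigma_S$: for a conjunction $A$ of ground $\Pi^C$-literals and $a \in C$, $a$ is implicitly defined by $A$ w.r.t. $\Sigma_S$ and $\mathcal{T}$ if $A \wedge A' \models_{\mathcal{T} \cup \mathcal{T}'} a \approx a'$; $a$ is explicitly defined if there is a term $t$ containing only symbols in $\Sigma_0$ and $\Sigma_S$ with $A \models_{\mathcal{T}} a \approx t$. $\mathcal{T}$ has the $\Sigma_S$-Beth definability property if for every such $A$ and $a$, implicit definability implies explicit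 definability. The $\Theta_{\mathcal{K}}(\Sigma_S)$-Beth definability property is this notion with $\Sigma_S$ replaced by $\Theta_{\mathcal{K}}(\Sigma_S)$.
   Formalization: Convexity of T alone does not suffice (T ∪ T' may fail to be convex), so it is also assumed that T is universal or T ∪ T' is convex; the defining term may contain universally read variables, which matters only when no ground term over Σ_0 ∪ Σ_S exists. *)

(* Defs.v *)
From Stdlib Require Import List Relation_Operators.
From mathcomp Require Import all_boot.
From mathcomp Require Import boolp classical_sets.

Set Implicit Arguments.
Unset Strict Implicit.
Unset Printing Implicit Defensive.

Local Open Scope classical_set_scope.

(* Pi = (Sigma_0 u Sigma_1, Pred); every family is indexed by the arity.      *)
Record signature := Signature {
  ifun : nat -> Type;  (* interpreted function symbols, Sigma_0 *)
  ufun : nat -> Type;  (* uninterpreted function symbols, Sigma_1 *)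
  psym : nat -> Type   (* Pred *)
}.

Definition fsym (S : signature) (n : nat) : Type := (ifun S n + ufun S n)%type.

(* Sigma_1 as a single type. *)
Definition usym (S : signature) : Type := {n : nat & ufun S n}.

(* Leaves are variables, constants, or both, depending on X: for a type K of  *)
(* constants, [term S K] is the type of ground Pi^K-terms, [term S nat] that  *)
(* of Pi-terms with variables, and [term S (K + nat)] that of Pi^K-terms with *)
(* variables.                                                                 *)
Inductive term (S : signature) (X : Type) : Type :=
| Leaf of X
| App n of fsym S n & ('I_n -> term S X).
Arguments Leaf {S X}.
Arguments App {S X n}.

Inductive atom (S : signature) (X : Type) : Type :=
| Eq of term S X & term S X
| Rel n of psym S n & ('I_n -> term S X).
Arguments Eq {S X}.
Arguments Rel {S X n}.

Inductive literal (S : signature) (X : Type) : Type :=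
| Pos of atom S X
| Neg of atom S X.
Arguments Pos {S X}.
Arguments Neg {S X}.

Inductive formula (S : signature) : Type :=
| FAtom of atom S nat
| FFalse
| FNot of formula S
| FAnd of formula S & formula S
| FOr of formula S & formula S
| FImp of formula S & formula S
| FAll of nat & formula S
| FEx of nat & formula S.
Arguments FFalse {S}.

(* Free variables of the axioms are implicitly universally quantified. *)
Definition theory (S : signature) : Type := set (formula S).

Definition clause (S : signature) : Type := seq (literal S nat).

Definition literal_formula (S : signature) (l : literal S nat) : formula S :=
  match l with Pos a => FAtom a | Neg a => FNot (FAtom a) end.

Definition clause_formula (S : signature) (c : clause S) : formula S :=
  foldr (fun l phi => FOr (literal_formula l) phi) FFalse c.

Definition clause_theory (S : signature) (K : set (clause S)) : theory S :=
  @clause_formula S @` K.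

Record structure (S : signature) := Structure {
  dom :> Type;
  dom_inhabited : inhabited dom;
  fun_interp : forall n, fsym S n -> ('I_n -> dom) -> dom;
  rel_interp : forall n, psym S n -> ('I_n -> dom) -> Prop
}.
Arguments fun_interp {S} M {n} : rename.
Arguments rel_interp {S} M {n} : rename.

Fixpoint eval (S : signature) (X : Type) (M : structure S) (v : X -> M)
    (t : term S X) : M :=
  match t with
  | Leaf x => v x
  | App n f ts => fun_interp M f (fun i => eval v (ts i))
  end.

Definition atom_holds (S : signature) (X : Type) (M : structure S)
    (v : X -> M) (a : atom S X) : Prop :=
  match a with
  | Eq s t => eval v s = eval v t
  | Rel n p ts => rel_interp M p (fun i => eval v (ts i))
  end.

Definition literal_holds (S : signature) (X : Type) (M : structure S)
    (v : X -> M) (l : literal S X) : Prop :=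
  match l with Pos a => atom_holds v a | Neg a => ~ atom_holds v a end.

Definition update (D : Type) (v : nat -> D) (x : nat) (d : D) : nat -> D :=
  fun y => if y == x then d else v y.

Fixpoint formula_holds (S : signature) (M : structure S) (v : nat -> M)
    (phi : formula S) : Prop :=
  match phi with
  | FAtom a => atom_holds v a
  | FFalse => False
  | FNot p => ~ formula_holds v p
  | FAnd p q => formula_holds v p /\ formula_holds v q
  | FOr p q => formula_holds v p \/ formula_holds v q
  | FImp p q => formula_holds v p -> formula_holds v q
  | FAll x p => forall d : M, formula_holds (update v x d) p
  | FEx x p => exists d : M, formula_holds (update v x d) p
  end.

Definition is_model (S : signature) (M : structure S) (T : theory S) : Prop :=
  forall phi, T phi -> forall v : nat -> M, formula_holds v phi.

(* A |=_T \/ D, for a finite conjunction A and a finite disjunction D. As a   *)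
(* constant is a leaf, the valuation [v] interprets the constants (and, if    *)
(* K also comprises variables, makes them universally quantified).            *)
Definition entails_or (S : signature) (T : theory S) (K : Type)
    (A : seq (literal S K)) (D : seq (atom S K)) : Prop :=
  forall (M : structure S), is_model M T -> forall v : K -> M,
    (forall l, List.In l A -> literal_holds v l) ->
    exists2 a, List.In a D & atom_holds v a.

Definition entails (S : signature) (T : theory S) (K : Type)
    (A : seq (literal S K)) (a : atom S K) : Prop :=
  entails_or T A [:: a].

Definition pos (S : signature) (K : Type) (A : seq (atom S K)) :
  seq (literal S K) := map Pos A.

Definition convex (S : signature) (T : theory S) : Prop :=
  forall (K : Type) (G D : seq (atom S K)), D <> [::] ->
    entails_or T (pos G) D ->
    exists2 a, List.In a D & entails T (pos G) a.

Fixpoint qfree (S : signature) (phi : formula S) : bool :=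
  match phi with
  | FAtom _ | FFalse => true
  | FNot p => qfree p
  | FAnd p q | FOr p q | FImp p q => qfree p && qfree q
  | FAll _ _ | FEx _ _ => false
  end.

Fixpoint universal (S : signature) (phi : formula S) : bool :=
  match phi with FAll _ p => universal p | _ => qfree phi end.

(* For a universal T, convexity of T (i.e. T is Horn, up to equivalence) is   *)
(* inherited by T u T'. For arbitrary first-order T it is not: if T says that *)
(* a set D, definable but not by a ground atom, is {d, f(d)} with f an        *)
(* involution, f(d) != d and d uninterpreted, then T may be convex, whereas   *)
(* T u T' entails d = d' \/ d = f(d') and neither disjunct.                   *)
Definition universal_theory (S : signature) (T : theory S) : Prop :=
  forall phi, T phi -> universal phi.

Fixpoint term_leaves (S : signature) (X : Type) (t : term S X) : set X :=
  match t with
  | Leaf x => [set x]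
  | App n f ts => [set x | exists i, term_leaves (ts i) x]
  end.

Fixpoint term_usyms (S : signature) (X : Type) (t : term S X) :
    set (usym S) :=
  match t with
  | Leaf _ => set0
  | App n f ts =>
      (if f is inr g then [set existT (ufun S) n g] else set0) `|`
      [set g | exists i, term_usyms (ts i) g]
  end.

Definition atom_leaves (S : signature) (X : Type) (a : atom S X) : set X :=
  match a with
  | Eq s t => term_leaves s `|` term_leaves t
  | Rel n p ts => [set x | exists i, term_leaves (ts i) x]
  end.

Definition atom_usyms (S : signature) (X : Type) (a : atom S X) :
    set (usym S) :=
  match a with
  | Eq s t => term_usyms s `|` term_usyms t
  | Rel n p ts => [set g | exists i, term_usyms (ts i) g]
  end.

Fixpoint formula_usyms (S : signature) (phi : formula S) : set (usym S) :=
  match phi with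
  | FAtom a => atom_usyms a
  | FFalse => set0
  | FNot p | FAll _ p | FEx _ p => formula_usyms p
  | FAnd p q | FOr p q | FImp p q => formula_usyms p `|` formula_usyms q
  end.

(* T is a theory over (Sigma_0, Pred): all its symbols are interpreted. *)
Definition interpreted_theory (S : signature) (T : theory S) : Prop :=
  forall phi, T phi -> formula_usyms phi = set0.

Definition literal_atom (S : signature) (X : Type) (l : literal S X) :
  atom S X := match l with Pos a | Neg a => a end.

Definition conj_constants (S : signature) (K : Type) (A : seq (atom S K)) :
    set K :=
  [set c | exists2 a, List.In a A & atom_leaves a c].

Definition conj_usyms (S : signature) (K : Type) (A : seq (atom S K)) :
    set (usym S) :=
  [set f | exists2 a, List.In a A & atom_usyms a f].

Definition co_occur (S : signature) (K : set (clause S)) (f g : usym S) :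
    Prop :=
  exists2 c, K c &
    (exists2 l, List.In l c & atom_usyms (literal_atom l) f) /\
    (exists2 l, List.In l c & atom_usyms (literal_atom l) g).

Definition Theta (S : signature) (K : set (clause S)) (X : set (usym S)) :
    set (usym S) :=
  [set g | exists2 f, X f & clos_refl_sym_trans (usym S) (co_occur K) f g].

Definition ThetaC (S : signature) (C : Type) (K : set (clause S))
    (SS : set (usym S + C)) : set (usym S + C) :=
  [set x | match x with
           | inl g => Theta K [set f | SS (inl f)] g
           | inr c => SS (inr c)
           end].

Definition intersection_sharing (S : signature) (X Y : set (usym S)) :
  set (usym S) := X `&` Y.

Definition Theta_sharing (S : signature) (K : set (clause S))
  (X Y : set (usym S)) : set (usym S) := Theta K X `&` Theta K Y.

(* Interpolants are ground: t has type [term S K]. *)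
Definition eq_interpolation (S : signature) (T : theory S)
    (sharing : set (usym S) -> set (usym S) -> set (usym S)) : Prop :=
  forall (K : Type) (A B : seq (atom S K)) (a b : K),
    conj_constants A a -> conj_constants B b ->
    entails T (pos (A ++ B)) (Eq (Leaf a) (Leaf b)) ->
    exists t : term S K,
      [/\ term_leaves t `<=` conj_constants A `&` conj_constants B,
          term_usyms t `<=` sharing (conj_usyms A) (conj_usyms B),
          entails T (pos (A ++ B)) (Eq (Leaf a) t) &
          entails T (pos (A ++ B)) (Eq t (Leaf b))].

Definition with_ufun (S : signature) (U : nat -> Type) : signature :=
  Signature (ifun S) U (psym S).

(* Renaming of the uninterpreted function symbols and of the leaves; the      *)
(* symbols of Sigma_0 and Pred are kept.                                      *)
Section Rename.
Variables (S : signature) (U : nat -> Type).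
Variable h : forall n, ufun S n -> U n.

Definition rename_fsym n (f : fsym S n) : fsym (with_ufun S U) n :=
  match f with inl g => inl g | inr g => inr (h g) end.

Fixpoint rename_term (X Y : Type) (k : X -> Y) (t : term S X) :
    term (with_ufun S U) Y :=
  match t with
  | Leaf x => Leaf (k x)
  | App n f ts => App (rename_fsym f) (fun i => rename_term k (ts i))
  end.

Definition rename_atom (X Y : Type) (k : X -> Y) (a : atom S X) :
    atom (with_ufun S U) Y :=
  match a with
  | Eq s t => Eq (rename_term k s) (rename_term k t)
  | Rel n p ts =>
      @Rel (with_ufun S U) Y n p (fun i => rename_term k (ts i))
  end.

Definition rename_literal (X Y : Type) (k : X -> Y) (l : literal S X) :
    literal (with_ufun S U) Y :=
  match l with
  | Pos a => Pos (rename_atom k a)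
  | Neg a => Neg (rename_atom k a)
  end.

Definition rename_clause (c : clause S) : clause (with_ufun S U) :=
  map (rename_literal id) c.

Fixpoint rename_formula (phi : formula S) : formula (with_ufun S U) :=
  match phi with
  | FAtom a => FAtom (rename_atom id a)
  | FFalse => FFalse
  | FNot p => FNot (rename_formula p)
  | FAnd p q => FAnd (rename_formula p) (rename_formula q)
  | FOr p q => FOr (rename_formula p) (rename_formula q)
  | FImp p q => FImp (rename_formula p) (rename_formula q)
  | FAll x p => FAll x (rename_formula p)
  | FEx x p => FEx x (rename_formula p)
  end.

End Rename.

(* The union of the signatures of T and T', with uninterpreted function       *)
(* symbols Sigma_1 u Sigma'_r, and the constants C u C'. Only symbols outside *)
(* SS = Sigma_S have a primed copy.                                           *)
Section Primed.
Variables (S : signature) (C : Type) (SS : set (usym S + C)).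

Definition ufun2 (n : nat) : Type :=
  (ufun S n + {f : ufun S n | ~ SS (inl (existT (ufun S) n f))})%type.

Definition sig2 : signature := with_ufun S ufun2.

Definition const2 : Type := (C + {c : C | ~ SS (inr c)})%type.

Definition keep_ufun (n : nat) (f : ufun S n) : ufun2 n := inl f.

Definition prime_ufun (n : nat) (f : ufun S n) : ufun2 n :=
  match pselect (SS (inl (existT (ufun S) n f))) with
  | left _ => inl f
  | right h => inr (exist _ f h)
  end.

Definition keep_const (c : C) : const2 := inl c.

Definition prime_const (c : C) : const2 :=
  match pselect (SS (inr c)) with
  | left _ => inl c
  | right h => inr (exist _ c h)
  end.

Definition keep_theory (T : theory S) : theory sig2 :=
  rename_formula keep_ufun @` T.

Definition prime_theory (T : theory S) : theory sig2 :=
  rename_formula prime_ufun @` T.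

Definition keep_clauses (K : set (clause S)) : set (clause sig2) :=
  rename_clause keep_ufun @` K.

Definition prime_clauses (K : set (clause S)) : set (clause sig2) :=
  rename_clause prime_ufun @` K.

Definition keep_conj (A : seq (literal S C)) : seq (literal sig2 const2) :=
  map (rename_literal keep_ufun keep_const) A.

Definition prime_conj (A : seq (literal S C)) : seq (literal sig2 const2) :=
  map (rename_literal prime_ufun prime_const) A.

Definition doubled_theory (T : theory S) : theory sig2 :=
  keep_theory T `|` prime_theory T.

Definition doubled_clauses (K : set (clause S)) : set (clause sig2) :=
  keep_clauses K `|` prime_clauses K.

Definition implicitly_defined (T : theory S) (A : seq (literal S C)) (a : C) :
    Prop :=
  entails (doubled_theory T) (keep_conj A ++ prime_conj A)
    (Eq (Leaf (keep_const a)) (Leaf (prime_const a))).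

(* A |=_T a = t for a term t over Sigma_0 u Sigma_S. Variables (the leaves    *)
(* [inr x]) are not excluded and are read universally: they may be replaced   *)
(* by any ground term over Sigma_0 u Sigma_S, so t can be taken ground unless *)
(* there is no such ground term at all. In that degenerate case a T-unsatis-  *)
(* fiable A (which implicitly defines every a) is explicit via a variable.    *)
Definition explicitly_defined (T : theory S) (A : seq (literal S C)) (a : C) :
    Prop :=
  exists t : term S (C + nat),
    [/\ forall c, term_leaves t (inl c) -> SS (inr c),
        forall f, term_usyms t f -> SS (inl f) &
        forall M : structure S, is_model M T ->
          forall (v : C -> M) (w : nat -> M),
            (forall l, List.In l A -> literal_holds v l) ->
            v a = eval (fun x => match x with inl c => v c | inr y => w y end)
                    t].

Definition beth_definability (T : theory S) : Prop :=
  forall (A : seq (literal S C)) (a : C),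
    implicitly_defined T A a -> explicitly_defined T A a.

End Primed.

Arguments keep_theory {S C} SS T.
Arguments prime_theory {S C} SS T.
Arguments keep_clauses {S C} SS K.
Arguments prime_clauses {S C} SS K.
Arguments doubled_theory {S C} SS T.
Arguments doubled_clauses {S C} SS K.

(* Main.v *)
(** Convexity removes the negative literals of [A /\ A']: either the positive
    parts alone entail [a = a'], or they entail the atom of some negative
    literal, and then [A] is unsatisfiable, since every model of [T] becomes a
    model of [T u T'] by giving primed symbols the meaning of their originals.
    In the first case the interpolant of the positive parts, with the primes
    erased, defines [a], by the same expansion.

    Convexity passes from a universal [T] to [T u T'] because the models of a
    convex universal theory are closed under products.

    For the second part, let [Z] be the Theta-closure of [Sigma_S]. Every clause
    of [K] has its uninterpreted symbols either all inside or all outside [Z],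
    so [T u T'], with primes taken outside [Sigma_S], entails its variant with
    primes taken outside [Z]. Moreover a class of [K u K'] that lies outside [Z]
    is either entirely primed or entirely unprimed, hence the symbols shared by
    [A] and its [Z]-primed copy are in [Z] once their primes are erased. *)

From Stdlib Require Import List Relation_Operators.
From mathcomp Require Import all_boot.
From mathcomp Require Import boolp classical_sets.
Require Import Defs.

Set Implicit Arguments.
Unset Strict Implicit.
Unset Printing Implicit Defensive.

Local Open Scope classical_set_scope.

(** * Reducts *)

(** Symbols are read along an arbitrary map, not only an inclusion, so that one construction covers
    both the two [T]-structures inside a model of [T u T'] and the expansion of a model of [T] by
    primed symbols. *)
Definition reduct (S1 S2 : signature)
    (hf : forall n, fsym S1 n -> fsym S2 n)
    (hp : forall n, psym S1 n -> psym S2 n) (M : structure S2) : structure S1 :=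
  Structure (dom_inhabited M) (fun n f => fun_interp M (hf n f))
    (fun n p => rel_interp M (hp n p)).

Definition ureduct (S : signature) (U : nat -> Type)
    (h : forall n, ufun S n -> U n) (M : structure (with_ufun S U)) :
    structure S :=
  reduct (rename_fsym h) (fun _ p => p) M.

(** Unlike for [rename_term], the target signature is arbitrary; this lets primes be erased, from
    [sig2 SS] back to [S]. *)
Fixpoint map_term (S1 S2 : signature) (X Y : Type)
    (hf : forall n, fsym S1 n -> fsym S2 n) (k : X -> Y) (t : term S1 X) :
    term S2 Y :=
  match t with
  | Leaf x => Leaf (k x)
  | App n f ts => App (hf n f) (fun i => map_term hf k (ts i))
  end.

Section Reduct.
Variables (S1 S2 : signature).
Variable hf : forall n, fsym S1 n -> fsym S2 n.
Variable hp : forall n, psym S1 n -> psym S2 n.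

Lemma eval_map_term (X Y : Type) (k : X -> Y) (M : structure S2) (v : Y -> M)
    (t : term S1 X) :
  eval v (map_term hf k t) = @eval S1 X (reduct hf hp M) (v \o k) t.
Proof.
by elim: t => [//|n f ts IH] /=; congr (fun_interp M _ _); apply: funext.
Qed.

Lemma map_term_leaves (X Y : Type) (k : X -> Y) (t : term S1 X) y :
  term_leaves (map_term hf k t) y -> exists2 x, term_leaves t x & y = k x.
Proof.
elim: t => [x ->|n f ts IH] /=; first by exists x.
by move=> [i /IH [x xi ->]]; exists x => //; exists i.
Qed.

End Reduct.

(** * Renaming of uninterpreted symbols and leaves *)

Section Rename.
Variables (S : signature) (U : nat -> Type).
Variable h : forall n, ufun S n -> U n.

Lemma rename_termE (X Y : Type) (k : X -> Y) (t : term S X) :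
  rename_term h k t = map_term (rename_fsym h) k t.
Proof. by elim: t => [//|n f ts IH] /=; congr App; apply: funext. Qed.

Lemma eval_rename (X Y : Type) (k : X -> Y) (M : structure (with_ufun S U))
    (v : Y -> M) (t : term S X) :
  eval v (rename_term h k t) = @eval S X (ureduct h M) (v \o k) t.
Proof. by rewrite rename_termE; apply: eval_map_term. Qed.

Lemma atom_holds_rename (X Y : Type) (k : X -> Y)
    (M : structure (with_ufun S U)) (v : Y -> M) (a : atom S X) :
  atom_holds v (rename_atom h k a) <->
  @atom_holds S X (ureduct h M) (v \o k) a.
Proof.
case: a => [s t|n p ts] /=; first by rewrite !eval_rename.
suff -> : (fun i => eval v (rename_term h k (ts i))) =
          (fun i => @eval S X (ureduct h M) (v \o k) (ts i)) by [].
by apply: funext => i; rewrite eval_rename.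
Qed.

Lemma literal_holds_rename (X Y : Type) (k : X -> Y)
    (M : structure (with_ufun S U)) (v : Y -> M) (l : literal S X) :
  literal_holds v (rename_literal h k l) <->
  @literal_holds S X (ureduct h M) (v \o k) l.
Proof. by case: l => a /=; rewrite atom_holds_rename. Qed.

Lemma formula_holds_rename (M : structure (with_ufun S U)) (phi : formula S)
    (v : nat -> M) :
  formula_holds v (rename_formula h phi) <->
  @formula_holds S (ureduct h M) v phi.
Proof.
elim: phi v => [a||p IHp|p IHp q IHq|p IHp q IHq|p IHp q IHq|x p IH|x p IH] v //=.
- exact: atom_holds_rename.
- by rewrite IHp.
- by rewrite IHp IHq.
- by rewrite IHp IHq.
- by rewrite IHp IHq.
- by split=> H d; apply/IH/H.
- by split=> -[d /IH H]; exists d.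
Qed.

Lemma is_model_rename (M : structure (with_ufun S U)) (T : theory S) :
  is_model M (rename_formula h @` T) <-> is_model (ureduct h M) T.
Proof.
split=> [H phi Tphi v|H _ [phi Tphi <-] v].
  by apply/formula_holds_rename/H; exists phi.
exact/formula_holds_rename/H.
Qed.

Definition rename_usym (f : usym S) : usym (with_ufun S U) :=
  existT (ufun (with_ufun S U)) (projT1 f) (h (projT2 f)).

Lemma rename_term_usyms (X Y : Type) (k : X -> Y) (t : term S X) g :
  term_usyms (rename_term h k t) g ->
  exists2 f, term_usyms t f & g = rename_usym f.
Proof.
elim: t => [//|n f ts IH] /= [|[i /IH [f' ? ->]]]; last first.
  by exists f' => //; right; exists i.
case: f => //= f ->; exists (existT _ n f) => //; by left.
Qed.

Lemma rename_atom_usyms (X Y : Type) (k : X -> Y) (a : atom S X) g :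
  atom_usyms (rename_atom h k a) g ->
  exists2 f, atom_usyms a f & g = rename_usym f.
Proof.
case: a => [s t|n p ts] /=.
  by move=> [] /rename_term_usyms [f ? ->]; exists f => //; [left|right].
by move=> [i /rename_term_usyms [f ? ->]]; exists f => //; exists i.
Qed.

Lemma rename_atom_leaves (X Y : Type) (k : X -> Y) (a : atom S X) y :
  atom_leaves (rename_atom h k a) y ->
  exists2 x, atom_leaves a x & y = k x.
Proof.
have leaves t : term_leaves (rename_term h k t) y ->
    exists2 x, term_leaves t x & y = k x.
  by rewrite rename_termE; apply: map_term_leaves.
case: a => [s t|n p ts] /=.
  by move=> [] /leaves [x ? ->]; exists x => //; [left|right].
by move=> [i /leaves [x ? ->]]; exists x => //; exists i.
Qed.

Lemma conj_constants_rename (X Y : Type) (k : X -> Y) (P : seq (atom S X)) y :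
  conj_constants (map (rename_atom h k) P) y -> exists x, y = k x.
Proof.
move=> [_ /in_map_iff [a [<- _]] ay].
by have [x _ ->] := rename_atom_leaves ay; exists x.
Qed.

Lemma conj_usyms_rename (X Y : Type) (k : X -> Y) (P : seq (atom S X)) :
  conj_usyms (map (rename_atom h k) P) `<=` range rename_usym.
Proof.
by move=> _ [_ /in_map_iff [a [<- _]] /rename_atom_usyms [f _ ->]]; exists f.
Qed.

Lemma rename_clause_formula (c : clause S) :
  rename_formula h (clause_formula c) = clause_formula (rename_clause h c).
Proof. by elim: c => [//|[] a c /= <-]. Qed.

Definition ufun_agree (h' : forall n, ufun S n -> U n) (X : set (usym S)) :
    Prop :=
  forall n (f : ufun S n), X (existT _ n f) -> h f = h' n f.

End Rename.

Section RenameAgree.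
Variables (S : signature) (U : nat -> Type).
Variables h h' : forall n, ufun S n -> U n.

Lemma rename_term_agree (X Y : Type) (k : X -> Y) (t : term S X) :
  ufun_agree h h' (term_usyms t) -> rename_term h k t = rename_term h' k t.
Proof.
elim: t => [//|n f ts IH] /= E; congr App; last first.
  by apply: funext => i; apply: IH => m g ?; apply: E; right; exists i.
by case: f E => //= f E; rewrite E //; left.
Qed.

Lemma rename_atom_agree (X Y : Type) (k : X -> Y) (a : atom S X) :
  ufun_agree h h' (atom_usyms a) -> rename_atom h k a = rename_atom h' k a.
Proof.
case: a => [s t|n p ts] /= E.
  by congr Eq; apply: rename_term_agree => m g ?; apply: E; [left|right].
congr Rel; apply: funext => i; apply: rename_term_agree => m g ?.
by apply: E; exists i.
Qed.

Lemma rename_formula_agree (phi : formula S) :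
  ufun_agree h h' (formula_usyms phi) ->
  rename_formula h phi = rename_formula h' phi.
Proof.
elim: phi => [a||p IHp|p IHp q IHq|p IHp q IHq|p IHp q IHq|x p IH|x p IH] //= E.
- by congr FAtom; apply: rename_atom_agree.
- by rewrite IHp.
- by rewrite IHp ?IHq // => m g ?; apply: E; [right|left].
- by rewrite IHp ?IHq // => m g ?; apply: E; [right|left].
- by rewrite IHp ?IHq // => m g ?; apply: E; [right|left].
- by rewrite IH.
- by rewrite IH.
Qed.

End RenameAgree.

Lemma clause_formula_usyms (S : signature) (c : clause S) f :
  formula_usyms (clause_formula c) f ->
  exists2 l, List.In l c & atom_usyms (literal_atom l) f.
Proof.
elim: c => [//|l c IH] /= [|/IH [l' ? ?]]; last by exists l' => //; right.
by move=> H; exists l; [left|case: l H].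
Qed.

Section ReductEq.
Variables (S1 S2 : signature) (hf hf' : forall n, fsym S1 n -> fsym S2 n).
Variables (hp : forall n, psym S1 n -> psym S2 n) (M : structure S2).
Hypothesis hfE : forall n (f : fsym S1 n), hf f = hf' f.

(** Composites of renamings agree symbol by symbol without being convertible; extensionality
    identifies the reducts. *)
Lemma literal_holds_reduct_eq (X : Type) (v : X -> M) (l : literal S1 X) :
  @literal_holds S1 X (reduct hf hp M) v l <->
  @literal_holds S1 X (reduct hf' hp M) v l.
Proof.
by have -> : hf = hf' by do 2 apply: functional_extensionality_dep => ?.
Qed.

Lemma is_model_reduct_eq (T : theory S1) :
  is_model (reduct hf hp M) T <-> is_model (reduct hf' hp M) T.
Proof.
by have -> : hf = hf' by do 2 apply: functional_extensionality_dep => ?.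
Qed.

End ReductEq.

Lemma literal_holds_reduct_id (S : signature)
    (hf : forall n, fsym S n -> fsym S n) (X : Type) (M : structure S)
    (v : X -> M) (l : literal S X) :
  (forall n f, hf n f = f) ->
  @literal_holds S X (reduct hf (fun _ p => p) M) v l <-> literal_holds v l.
Proof.
move=> E; have -> : hf = fun n f => f.
  by do 2 apply: functional_extensionality_dep => ?.
by case: M v.
Qed.

Lemma is_model_reduct_id (S : signature)
    (hf : forall n, fsym S n -> fsym S n) (M : structure S) (T : theory S) :
  (forall n f, hf n f = f) ->
  is_model (reduct hf (fun _ p => p) M) T <-> is_model M T.
Proof.
move=> E; have -> : hf = fun n f => f.
  by do 2 apply: functional_extensionality_dep => ?.
by case: M.
Qed.

(** * Products of models *)

Section Product.
Variables (S : signature) (I : Type) (F : I -> structure S).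

Definition prod_structure : structure S :=
  Structure (inhabits (fun i => inhabited_witness (dom_inhabited (F i))))
    (fun n f args i => fun_interp (F i) f (fun j => args j i))
    (fun n p args => forall i, rel_interp (F i) p (fun j => args j i)).

Lemma eval_prod (X : Type) (v : X -> prod_structure) (t : term S X) i :
  eval v t i = eval (fun x => v x i) t.
Proof.
by elim: t => [//|n f ts IH] /=; congr (fun_interp (F i) _ _); apply: funext.
Qed.

(** Atoms pass between product and factors in both directions, negated atoms do not; this is why
    [qfree_prod] invokes convexity. *)
Lemma atom_holds_prod (X : Type) (v : X -> prod_structure) (a : atom S X) :
  atom_holds v a <-> forall i, atom_holds (fun x => v x i) a.
Proof.
case: a => [s t|n p ts] /=.
  split=> [E i|E]; first by rewrite -!eval_prod E.
  by apply: functional_extensionality_dep => i; rewrite !eval_prod E.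
have E i : (fun j => eval v (ts j) i) = (fun j => eval (fun x => v x i) (ts j)).
  by apply: funext => j; rewrite eval_prod.
by split=> H i; move: (H i); rewrite E.
Qed.

End Product.

Fixpoint formula_atoms (S : signature) (phi : formula S) : seq (atom S nat) :=
  match phi with
  | FAtom a => [:: a]
  | FFalse => [::]
  | FNot p | FAll _ p | FEx _ p => formula_atoms p
  | FAnd p q | FOr p q | FImp p q => formula_atoms p ++ formula_atoms q
  end.

(** A Boolean combination depends only on the truth values of its atoms, even across two
    structures. *)
Lemma qfree_holds_agree (S : signature) (M N : structure S) (v : nat -> M)
    (w : nat -> N) (phi : formula S) :
  qfree phi ->
  (forall a, List.In a (formula_atoms phi) -> atom_holds v a <-> atom_holds w a) ->
  formula_holds v phi <-> formula_holds w phi.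
Proof.
elim: phi => [a||p IHp|p IHp q IHq|p IHp q IHq|p IHp q IHq|//|//] //=.
- by move=> _ E; apply: E; left.
- by move=> fp E; rewrite IHp.
all: move=> /andP[fp fq] E.
all: by rewrite IHp ?IHq // => a ?; apply: E; apply/in_or_app; [right|left].
Qed.

Section ProductConvex.
Variables (S : signature) (T : theory S) (I : Type) (i0 : I).
Variable F : I -> structure S.
Hypotheses (convT : convex T) (modF : forall i, is_model (F i) T).

(* Otherwise, the atoms of phi true in the product entail modulo T the
   disjunction of the false ones, hence one of these; but as the true ones hold
   in each factor, so does this one. *)
Lemma qfree_prod (phi : formula S) :
  qfree phi ->
  (forall M : structure S, is_model M T -> forall v : nat -> M, formula_holds v phi) ->
  forall v : nat -> prod_structure F, formula_holds v phi.
Proof.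
move=> qphi Tphi v; apply: contrapT => nphi.
pose tt a := `[< atom_holds v a >].
pose P := List.filter tt (formula_atoms phi).
pose N := List.filter (fun a => ~~ tt a) (formula_atoms phi).
(* If [w] made all of [P] and nothing in [N] true, it would agree with [v] on the atoms of [phi],
   and [phi] would hold at [v]. *)
have PN (M : structure S) (w : nat -> M) : is_model M T ->
    (forall a, List.In a P -> atom_holds w a) ->
    exists2 a, List.In a N & atom_holds w a.
  move=> modM wP; apply: contrapT => wN; apply: nphi.
  apply/(qfree_holds_agree qphi _ (w := w)); last exact: Tphi.
  move=> a aphi; split=> [va|wa]; first by apply/wP/filter_In; split=> //; apply/asboolP.
  apply: contrapT => va; apply: wN; exists a => //.
  by apply/filter_In; split=> //; apply/negP => /asboolP.
have FP i a : List.In a P -> atom_holds (fun x => v x i) a.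
  by move=> /filter_In [_ /asboolP /atom_holds_prod].
(* [convex] speaks of nonempty disjunctions only; the factor at [i0] satisfies [P], hence some atom
   of [N]. *)
have Nne : N <> [::].
  by move=> N0; have [a] := PN (F i0) _ (@modF i0) (FP i0); rewrite N0.
have [a aN Pa] : exists2 a, List.In a N & entails T (pos P) a.
  apply: convT => // M modM w wP; apply: PN => // a aP.
  by apply: (wP (Pos a)); apply/in_map_iff; exists a.
have /filter_In [_ /negP na] := aN; apply: na.
apply/asboolP/atom_holds_prod => i.
have [|_ [<- //|[]]] := Pa (F i) (@modF i) (fun x => v x i).
by move=> _ /in_map_iff [b [<- bP]]; apply: FP.
Qed.

Lemma universal_prod (phi : formula S) :
  universal phi ->
  (forall M : structure S, is_model M T -> forall v : nat -> M, formula_holds v phi) ->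
  forall v : nat -> prod_structure F, formula_holds v phi.
Proof.
elim: phi => [a||p _|p _ q _|p _ q _|p _ q _|x p IH|x p _] up Tp;
  try exact: qfree_prod up Tp.
move=> v d; apply: IH => // M modM w.
(* Instantiating [x] with its current value [w x] leaves [w] unchanged. *)
have := Tp M modM w (w x); congr formula_holds.
by apply: funext => y; rewrite /update; case: eqP => // ->.
Qed.

Lemma is_model_prod : universal_theory T -> is_model (prod_structure F) T.
Proof.
move=> uT phi Tphi; apply: universal_prod; first exact: uT.
by move=> M modM; apply: modM.
Qed.

End ProductConvex.

(** * Convexity of the doubled theory *)

Lemma is_model_doubled (S : signature) (C : Type) (SS : set (usym S + C))
    (T : theory S) (M : structure (sig2 SS)) :
  is_model M (doubled_theory SS T) <->
  is_model (ureduct (@keep_ufun S C SS) M) T /\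
  is_model (ureduct (@prime_ufun S C SS) M) T.
Proof.
split=> [H|[/is_model_rename kM /is_model_rename pM] phi [/kM|/pM] //].
by split; apply/is_model_rename => phi ?; apply: H; [left|right].
Qed.

(** If no disjunct were entailed, each would fail in some model of the premises. The product of
    these models satisfies the premises and refutes all disjuncts at once. *)
Lemma convex_doubled (S : signature) (C : Type) (SS : set (usym S + C))
    (T : theory S) :
  convex T -> universal_theory T -> convex (doubled_theory SS T).
Proof.
move=> convT uT K G [//|a0 D] _ GD; apply: contrapT => nD.
(* Countermodels are indexed by all of [nat]: past the end of the list, [nth] returns the default
   [a0], itself a disjunct. *)
have cex i : exists Mv : {M : structure (sig2 SS) & K -> M},
    [/\ is_model (projT1 Mv) (doubled_theory SS T),
        forall a, List.In a G -> atom_holds (projT2 Mv) a &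
        ~ atom_holds (projT2 Mv) (List.nth i (a0 :: D) a0)].
  apply: contrapT => nM; apply: nD; exists (List.nth i (a0 :: D) a0).
    by have [//|->] := nth_in_or_default i (a0 :: D) a0; left.
  move=> M modM v vG; exists (List.nth i (a0 :: D) a0); first by left.
  apply: contrapT => va; apply: nM; exists (existT _ M v); split=> //= a aG.
  by apply: (vG (Pos a)); apply/in_map_iff; exists a.
have [F FP] := choice cex.
pose M i := projT1 (F i).
have modM i : is_model (M i) (doubled_theory SS T) by case: (FP i).
have modP : is_model (prod_structure M) (doubled_theory SS T).
  (* The reduct of the product to either copy is, by conversion, the product of the reducts, which
     are models of [T]. *)
  have prodT h : (forall i, is_model (ureduct h (M i)) T) ->
      is_model (ureduct h (prod_structure M)) T.
    by move=> modh; apply: (is_model_prod 0 convT modh uT).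
  by apply/is_model_doubled; split; apply: prodT => i;
    case/is_model_doubled: (modM i).
have [|a aD] := GD _ modP (fun x i => projT2 (F i) x).
  move=> _ /in_map_iff [a [<- aG]]; apply/atom_holds_prod => i.
  by case: (FP i) => _ /(_ a aG).
move=> /atom_holds_prod; have [i [_ <-]] := In_nth _ _ a0 aD.
by move=> /(_ i); case: (FP i).
Qed.

(** * From interpolation to definability *)

Lemma in_cat (X : Type) (s t : seq X) x :
  List.In x (s ++ t) <-> List.In x s \/ List.In x t.
Proof. exact: in_app_iff. Qed.

Lemma pos_in (S : signature) (X : Type) (G : seq (atom S X)) a :
  List.In a G -> List.In (Pos a) (pos G).
Proof. exact: in_map. Qed.

Lemma in_pos (S : signature) (X : Type) (G : seq (atom S X)) l :
  List.In l (pos G) -> exists2 a, List.In a G & l = Pos a.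
Proof. by move=> /in_map_iff [a [<- aG]]; exists a. Qed.

Definition pos_part (S : signature) (X : Type) (A : seq (literal S X)) :
    seq (atom S X) :=
  pmap (fun l => if l is Pos a then Some a else None) A.

Definition neg_part (S : signature) (X : Type) (A : seq (literal S X)) :
    seq (atom S X) :=
  pmap (fun l => if l is Neg a then Some a else None) A.

Lemma in_pos_part (S : signature) (X : Type) (A : seq (literal S X)) a :
  List.In a (pos_part A) <-> List.In (Pos a) A.
Proof.
elim: A => [//|[] b A IH] /=; rewrite IH; first by split=> -[[->]|]; auto.
by split=> [|[]]; auto.
Qed.

Lemma in_neg_part (S : signature) (X : Type) (A : seq (literal S X)) a :
  List.In a (neg_part A) <-> List.In (Neg a) A.
Proof.
elim: A => [//|[] b A IH] /=; rewrite IH; last by split=> -[[->]|]; auto.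
by split=> [|[]]; auto.
Qed.

Lemma pos_part_rename (S : signature) (U : nat -> Type)
    (h : forall n, ufun S n -> U n) (X Y : Type) (k : X -> Y)
    (A : seq (literal S X)) :
  pos_part (map (rename_literal h k) A) = map (rename_atom h k) (pos_part A).
Proof. by elim: A => [//|[] a A IH] /=; rewrite -?IH. Qed.

(** Negative literals move to the right as their atoms; together with [a] they form a nonempty
    disjunction, to which convexity applies. *)
Lemma convex_entails (S : signature) (T : theory S) (X : Type)
    (A : seq (literal S X)) (a : atom S X) :
  convex T -> entails T A a ->
  entails T (pos (pos_part A)) a \/
  exists2 b, List.In (Neg b) A & entails T (pos (pos_part A)) b.
Proof.
move=> convT Aa.
have [//||b [<-|/in_neg_part bA] Pb] := convT X (pos_part A) (a :: neg_part A).
- move=> M modM v vP; apply: contrapT => nD; have [|_ [<-|[]] va] := Aa M modM v.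
    case=> b bA /=.
      by apply: (vP (Pos b)); apply/in_map_iff; exists b; split=> //; apply/in_pos_part.
    by move=> vb; apply: nD; exists b => //; right; apply/in_neg_part.
  by apply: nD; exists a => //; left.
- by left.
- by right; exists b.
Qed.

Lemma entails_weaken (S : signature) (T : theory S) (X : Type)
    (A B : seq (literal S X)) (a : atom S X) :
  List.incl A B -> entails T A a -> entails T B a.
Proof. by move=> AB Aa M modM v vB; apply: Aa => // l /AB/vB. Qed.

(** * Erasing primes and changing the set of shared symbols *)

Section Beth.
Variables (S : signature) (C : Type).

Definition unprime_ufun (SS : set (usym S + C)) n (f : ufun2 SS n) : ufun S n :=
  match f with inl g => g | inr g => proj1_sig g end.

Definition unprime_fsym (SS : set (usym S + C)) n (f : fsym (sig2 SS) n) :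
    fsym S n :=
  match f with inl g => inl g | inr g => inr (unprime_ufun g) end.

Definition unprime_usym (SS : set (usym S + C)) (f : usym (sig2 SS)) : usym S :=
  existT (ufun S) (projT1 f) (unprime_ufun (projT2 f)).

Definition unprime_const (SS : set (usym S + C)) (c : const2 SS) : C :=
  match c with inl d => d | inr d => proj1_sig d end.

Lemma prime_ufunK (SS : set (usym S + C)) n (f : ufun S n) :
  unprime_ufun (prime_ufun SS f) = f.
Proof. by rewrite /prime_ufun; case: pselect. Qed.

Lemma prime_constK (SS : set (usym S + C)) (c : C) :
  unprime_const (prime_const SS c) = c.
Proof. by rewrite /prime_const; case: pselect. Qed.

Lemma rename_usymK (SS : set (usym S + C))
    (h : forall n, ufun S n -> ufun2 SS n) f :
  (forall n (g : ufun S n), unprime_ufun (h n g) = g) ->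
  unprime_usym (rename_usym h f) = f.
Proof. by case: f => n f hK; rewrite /unprime_usym /= hK. Qed.

Lemma map_unprime_usyms (SS : set (usym S + C)) (X Y : Type) (k : X -> Y)
    (t : term (sig2 SS) X) f :
  term_usyms (map_term (@unprime_fsym SS) k t) f ->
  exists2 g, term_usyms t g & f = unprime_usym g.
Proof.
elim: t => [//|n g ts IH] /= [|[i /IH [g' ? ->]]]; last first.
  by exists g' => //; right; exists i.
case: g => //= g ->; exists (existT (ufun (sig2 SS)) n g) => //; by left.
Qed.

Definition expansion (SS : set (usym S + C)) (M : structure S) :
    structure (sig2 SS) :=
  reduct (@unprime_fsym SS) (fun _ p => p) M.

(** Keeping or priming, followed by erasing primes, is the identity, so both copies of [T] are read
    in [M] itself. *)
Lemma is_model_expansion (SS : set (usym S + C)) (M : structure S)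
    (T : theory S) :
  is_model M T -> is_model (expansion SS M) (doubled_theory SS T).
Proof.
move=> modM; apply/is_model_doubled; split.
  by apply: (is_model_reduct_id _ _ _).2 modM => n [].
by apply: (is_model_reduct_id _ _ _).2 modM => n [//|f] /=; rewrite prime_ufunK.
Qed.

Lemma literal_holds_expansion (SS : set (usym S + C)) (X Y : Type)
    (h : forall n, ufun S n -> ufun2 SS n) (k : X -> Y) (M : structure S)
    (v : Y -> M) (l : literal S X) :
  (forall n (f : ufun S n), unprime_ufun (h n f) = f) ->
  @literal_holds _ _ (expansion SS M) v (rename_literal h k l) <->
  @literal_holds _ _ M (v \o k) l.
Proof.
move=> hK; rewrite literal_holds_rename.
by apply: literal_holds_reduct_id => n [//|f] /=; rewrite hK.
Qed.

Variables SS Z : set (usym S + C).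

(* The [Z]-primed copies, written with the symbols primed relative to [SS]. *)
Definition transfer_ufun n (f : ufun2 Z n) : ufun2 SS n :=
  match f with inl g => inl g | inr g => prime_ufun SS (proj1_sig g) end.

(** A symbol receives a prime here exactly if it lies outside both [Z] and [SS]. *)
Definition transfer_prime n (f : ufun S n) : ufun2 SS n :=
  transfer_ufun (prime_ufun Z f).

Lemma transfer_primeK n (f : ufun S n) : unprime_ufun (transfer_prime f) = f.
Proof.
rewrite /transfer_prime {1}/prime_ufun; case: pselect => //= _.
exact: prime_ufunK.
Qed.

Lemma transfer_primeT n (f : ufun S n) :
  Z (inl (existT _ n f)) -> transfer_prime f = keep_ufun SS f.
Proof. by rewrite /transfer_prime {1}/prime_ufun; case: pselect. Qed.

Lemma transfer_primeF n (f : ufun S n) :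
  ~ Z (inl (existT _ n f)) -> transfer_prime f = prime_ufun SS f.
Proof. by rewrite /transfer_prime {1}/prime_ufun; case: pselect. Qed.

Definition primed (g : usym (sig2 SS)) : bool :=
  if projT2 g is inr _ then true else false.

Lemma transfer_prime_primed f :
  (forall g, SS (inl g) -> Z (inl g)) -> ~ Z (inl f) ->
  primed (rename_usym transfer_prime f).
Proof.
case: f => n f sub nZ; rewrite /rename_usym /= transfer_primeF //.
by rewrite /primed /= /prime_ufun; case: pselect => [/sub/nZ|].
Qed.

Variable T : theory S.

Hypothesis transferT : forall phi, T phi ->
  ufun_agree transfer_prime (@keep_ufun S C SS) (formula_usyms phi) \/
  ufun_agree transfer_prime (@prime_ufun S C SS) (formula_usyms phi).

(** By [transferT], the transferred copy of each axiom coincides with its kept or its primed copy,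
    and both are axioms of the doubled theory. *)
Lemma is_model_transfer (M : structure (sig2 SS)) :
  is_model M (doubled_theory SS T) ->
  is_model (ureduct (S := sig2 Z) transfer_ufun M) (doubled_theory Z T).
Proof.
move=> /is_model_doubled [kM pM]; apply/is_model_doubled; split.
  by apply: (is_model_reduct_eq _ _ _ _).2 kM => n [].
have tM : is_model (ureduct transfer_prime M) T.
  move=> phi Tphi v; apply/formula_holds_rename.
  case: (transferT Tphi) => /rename_formula_agree ->.
    exact/formula_holds_rename/kM.
  exact/formula_holds_rename/pM.
by apply: (is_model_reduct_eq _ _ _ _).2 tM => n [].
Qed.

(** Only function symbols are transferred: constants are a parameter of [entails], so [const2 Z] can
    be used over [sig2 SS]. *)
Definition transfer_conj (A : seq (literal S C)) :
    seq (literal (sig2 SS) (const2 Z)) :=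
  map (rename_literal (@keep_ufun S C SS) (@keep_const S C Z)) A ++
  map (rename_literal transfer_prime (@prime_const S C Z)) A.

Lemma implicitly_defined_transfer (A : seq (literal S C)) (a : C) :
  implicitly_defined Z T A a ->
  entails (doubled_theory SS T) (transfer_conj A)
    (Eq (Leaf (keep_const Z a)) (Leaf (prime_const Z a))).
Proof.
move=> impl M modM v vL.
have [|_ [<-|[]] va] := impl _ (is_model_transfer modM) v; last first.
  by exists (Eq (Leaf (keep_const Z a)) (Leaf (prime_const Z a))); first left.
move=> _ /in_cat [] /in_map_iff [l [<- lA]]; apply/literal_holds_rename.
  have /vL/literal_holds_rename : List.In
      (rename_literal (@keep_ufun S C SS) (@keep_const S C Z) l)
      (transfer_conj A) by apply/in_cat; left; apply: in_map.
  by apply: (literal_holds_reduct_eq _ _ _ _).2 => n [].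
have /vL/literal_holds_rename : List.In
    (rename_literal transfer_prime (@prime_const S C Z) l)
    (transfer_conj A) by apply/in_cat; right; apply: in_map.
by apply: (literal_holds_reduct_eq _ _ _ _).2 => n [].
Qed.

Variable sharing : set (usym (sig2 SS)) -> set (usym (sig2 SS)) ->
  set (usym (sig2 SS)).

Hypothesis sharingZ : forall X Y,
  X `<=` range (rename_usym (@keep_ufun S C SS)) ->
  Y `<=` range (rename_usym transfer_prime) ->
  forall g, sharing X Y g -> Z (inl (unprime_usym g)).

(** Both parts of the theorem are instances, with [Z] equal to [SS] or to its closure. All that is
    asked of the notion of sharing is [sharingZ]. *)
Lemma beth_of_interpolation :
  convex (doubled_theory SS T) -> eq_interpolation (doubled_theory SS T) sharing ->
  beth_definability Z T.
Proof.
move=> convTT interp A a /implicitly_defined_transfer.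
set L := transfer_conj A => La.
have LM (M : structure S) (v : C -> M) : (forall l, List.In l A -> literal_holds v l) ->
    forall l, List.In l L ->
      @literal_holds _ _ (expansion SS M) (v \o @unprime_const Z) l.
  move=> vA _ /in_cat [] /in_map_iff [l [<- /vA lA]];
    apply/literal_holds_expansion => //; first exact: transfer_primeK.
  suff -> : (v \o @unprime_const Z) \o @prime_const S C Z = v by [].
  by apply: funext => c /=; rewrite prime_constK.
have LMpos (M : structure S) (v : C -> M) : (forall l, List.In l A -> literal_holds v l) ->
    forall l, List.In l (pos (pos_part L)) ->
      @literal_holds _ _ (expansion SS M) (v \o @unprime_const Z) l.
  by move=> vA _ /in_map_iff [b [<- /in_pos_part]]; apply: LM.
have [Pa|[b bL Pb]] := convex_entails convTT La; last first.
  (* A is unsatisfiable *)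
  exists (Leaf (inr 0)); split=> // M modM v w vA; exfalso.
  have [|_ [<-|[]] vb] := Pb _ (is_model_expansion modM) (v \o @unprime_const Z).
    exact: LMpos.
  exact: (LM M v vA (Neg b) bL vb).
(* The interpolation property requires [a] and its copy to occur in the two conjunctions, which the
   positive part of [A] need not ensure; a trivial equation does. *)
pose P := Eq (Leaf a) (Leaf a) :: pos_part A.
pose PL : seq (atom (sig2 SS) (const2 Z)) :=
  map (rename_atom (@keep_ufun S C SS) (@keep_const S C Z)) P.
pose PR : seq (atom (sig2 SS) (const2 Z)) :=
  map (rename_atom transfer_prime (@prime_const S C Z)) P.
have PLM (M : structure S) (v : C -> M) : (forall l, List.In l A -> literal_holds v l) ->
    forall l, List.In l (pos (PL ++ PR)) ->
      @literal_holds _ _ (expansion SS M) (v \o @unprime_const Z) l.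
  move=> vA _ /in_pos [b /in_cat bP ->].
  have [//|/pos_in/(LMpos M v vA) //] :
    atom_holds (M := expansion SS M) (v \o @unprime_const Z) b \/
    List.In b (pos_part L).
  case: bP => /= -[<-|bP]; try by left.
    right; apply/in_pos_part/in_cat; left; apply/in_pos_part.
    by rewrite pos_part_rename.
  right; apply/in_pos_part/in_cat; right; apply/in_pos_part.
  by rewrite pos_part_rename.
have PaLR : entails (doubled_theory SS T) (pos (PL ++ PR))
    (Eq (Leaf (keep_const Z a)) (Leaf (prime_const Z a))).
  apply: entails_weaken Pa => _ /in_map_iff [b [<- /in_pos_part/in_cat bL]].
  apply: pos_in; apply/in_cat.
  by case: bL => /in_pos_part; rewrite pos_part_rename; [left|right]; right.
have [||t [leaves usyms at_ _]] := interp _ _ _ _ _ _ _ PaLR.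
- by exists (Eq (Leaf (keep_const Z a)) (Leaf (keep_const Z a))); left.
- by exists (Eq (Leaf (prime_const Z a)) (Leaf (prime_const Z a))); left.
exists (map_term (@unprime_fsym SS) (inl \o @unprime_const Z) t); split.
(* A constant common to both sides is unprimed, being on the left, and a [Z]-primed copy, being on
   the right; so it belongs to [Z]. *)
- move=> c ct; have [x /leaves [Lx Rx] [->]] := map_term_leaves ct.
  have [d xd] := conj_constants_rename Lx.
  have [d' xd'] := conj_constants_rename Rx.
  by move: xd'; rewrite xd /prime_const; case: pselect => // Zd' [->].
- move=> f /map_unprime_usyms [g /usyms gs ->].
  by apply: sharingZ gs; apply: conj_usyms_rename.
- move=> M modM v w vA.
  (* The interpolant without primes has in [M] the value that the interpolant itself has in the
     expansion. *)
  rewrite (@eval_map_term (sig2 SS) S (@unprime_fsym SS) (fun _ p => p)).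
  have [|_ [<-|[]] //] := at_ _ (is_model_expansion modM) (v \o @unprime_const Z).
  exact: PLM.
Qed.

End Beth.

(** For [Z = SS] the transferred copy is the ordinary primed one. A symbol common to both sides is
    unprimed, so on the right it can only be the copy of a symbol of [SS]. *)
Lemma beth_of_intersection_interpolation (S : signature) (C : Type)
    (T : theory S) (SS : set (usym S + C)) :
  convex (doubled_theory SS T) ->
  eq_interpolation (doubled_theory SS T) (@intersection_sharing (sig2 SS)) ->
  beth_definability SS T.
Proof.
have E n (f : ufun S n) : transfer_prime SS SS f = prime_ufun SS f.
  have [sf|nf] := pselect (SS (inl (existT _ n f))); last exact: transfer_primeF.
  by rewrite transfer_primeT // /prime_ufun; case: pselect.
apply: beth_of_interpolation => [phi _|X Y XK YK g [/XK [f _ fg] /YK [f' _ f'g]]].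
  by right=> n f _; apply: E.
have [Zf'|nZf'] := pselect (SS (inl f')).
  by rewrite -f'g rename_usymK //; apply: transfer_primeK.
by have := transfer_prime_primed (fun _ => id) nZf'; rewrite f'g -fg.
Qed.

(** * Co-occurrence classes of the doubled clauses *)

Lemma co_occur_rename (S : signature) (U : nat -> Type)
    (h : forall n, ufun S n -> U n) (K : set (clause S)) f g :
  co_occur (rename_clause h @` K) f g ->
  exists f0 g0, [/\ co_occur K f0 g0, f = rename_usym h f0 & g = rename_usym h g0].
Proof.
have usyms l f1 : atom_usyms (literal_atom (rename_literal h id l)) f1 ->
    exists2 f0, atom_usyms (literal_atom l) f0 & f1 = rename_usym h f0.
  by case: l => a; apply: rename_atom_usyms.
move=> [_ [c Kc <-] [[_ /in_map_iff [l [<- lc]] /usyms [f0 lf ->]]]].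
move=> [_ /in_map_iff [l' [<- lc']] /usyms [g0 lg ->]].
exists f0, g0; split=> //; exists c => //.
by split; [exists l|exists l'].
Qed.

Lemma co_occur_sym (S : signature) (K : set (clause S)) f g :
  co_occur K f g -> co_occur K g f.
Proof. by move=> [c Kc [cf cg]]; exists c. Qed.

Section ThetaClosure.
Variables (S : signature) (C : Type) (SS : set (usym S + C)).
Variable K : set (clause S).

Let Z := ThetaC K SS.

Lemma sub_ThetaC f : SS (inl f) -> Z (inl f).
Proof. by move=> sf; exists f => //; apply: rst_refl. Qed.

Lemma co_occur_ThetaC f g : co_occur K f g -> Z (inl f) -> Z (inl g).
Proof.
by move=> fg [s ss sf]; exists s => //; apply: rst_trans sf _; apply: rst_step.
Qed.

(** An invariant of the co-occurrence classes: symbols in [Z] up to primes are lumped together, and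
    outside [Z] the two copies are kept apart. *)
Definition side (g : usym (sig2 SS)) : option bool :=
  if pselect (Z (inl (unprime_usym g))) then None else Some (primed g).

(** A clause has all or none of its symbols in [Z] up to primes. In the latter case a kept clause
    has no primes, and a primed one only primed symbols, as [SS] is contained in [Z]. *)
Lemma co_occur_side f g :
  co_occur (doubled_clauses SS K) f g -> side f = side g.
Proof.
have side_rename h f0 g0 :
    (forall n (f : ufun S n), unprime_ufun (h n f) = f) ->
    (~ Z (inl f0) -> ~ Z (inl g0) ->
     primed (SS := SS) (rename_usym h f0) = primed (SS := SS) (rename_usym h g0)) ->
    co_occur K f0 g0 ->
    side (rename_usym h f0) = side (rename_usym h g0).
  move=> hK hp fg; rewrite /side !rename_usymK //.
  case: pselect => [Zf|nZf]; case: pselect => [Zg|nZg] //=.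
  - by case: nZg; apply: co_occur_ThetaC Zf.
  - by case: nZf; apply: co_occur_ThetaC Zg; apply: co_occur_sym.
  - by rewrite hp.
have prime_primed f0 : ~ Z (inl f0) ->
    primed (SS := SS) (rename_usym (@prime_ufun S C SS) f0) = true.
  case: f0 => n f0 nZ; rewrite /primed /= /prime_ufun.
  by case: pselect => [/sub_ThetaC/nZ|].
move=> [c [Kc|Kc] cfg].
  have /co_occur_rename [f0 [g0 [fg -> ->]]] : co_occur (keep_clauses SS K) f g.
    by exists c.
  exact: side_rename.
have /co_occur_rename [f0 [g0 [fg -> ->]]] : co_occur (prime_clauses SS K) f g.
  by exists c.
apply: side_rename fg => [n ?|nf ng]; first exact: prime_ufunK.
by rewrite !prime_primed.
Qed.

Lemma Theta_side X g :
  Theta (doubled_clauses SS K) X g -> exists2 f, X f & side f = side g.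
Proof.
move=> [f Xf fg]; exists f => //.
by elim: fg => [|//|? ? _ <-|? ? ? _ -> _ ->] // ? ?; apply: co_occur_side.
Qed.

(** Outside [Z], the class of [g] would be unprimed according to [X] and primed according to [Y]. *)
Lemma Theta_sharing_sub X Y g :
  X `<=` range (rename_usym (@keep_ufun S C SS)) ->
  Y `<=` range (rename_usym (@transfer_prime S C SS Z)) ->
  Theta_sharing (doubled_clauses SS K) X Y g -> Z (inl (unprime_usym g)).
Proof.
move=> XK YK [/Theta_side [_ /XK [f _ <-] fg] /Theta_side [_ /YK [f' _ <-] f'g]].
have [//|nZg] := pselect (Z (inl (unprime_usym g))).
move: fg f'g; rewrite /side rename_usymK // rename_usymK; last exact: transfer_primeK.
case: (pselect (Z (inl (unprime_usym g)))) => // nZg'.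
case: (pselect (Z (inl f))) => // nZf [pf]; case: pselect => // nZf' [pf'].
have : primed (rename_usym (@transfer_prime S C SS Z) f').
  by apply: transfer_prime_primed => //; apply: sub_ThetaC.
by rewrite pf' -pf.
Qed.

(** Axioms of [T0] have no symbols to rename. A clause that meets [Z] lies inside it and is kept;
    any other is primed throughout. *)
Lemma ThetaC_transfer (T0 : theory S) phi :
  interpreted_theory T0 -> (T0 `|` clause_theory K) phi ->
  ufun_agree (@transfer_prime S C SS Z) (@keep_ufun S C SS) (formula_usyms phi) \/
  ufun_agree (@transfer_prime S C SS Z) (@prime_ufun S C SS) (formula_usyms phi).
Proof.
move=> intT0 [/intT0 ->|[c Kc <-]]; first by left.
have [[f [fc Zf]]|nZ] := pselect (exists f,
    formula_usyms (clause_formula c) f /\ Z (inl f)).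
  left=> n g gc; apply: transfer_primeT; apply: co_occur_ThetaC Zf.
  by exists c => //; split; apply: clause_formula_usyms.
by right=> n g gc; apply: transfer_primeF => Zg; apply: nZ; eexists; split; eassumption.
Qed.

(** Priming fixes the axioms of [T0], so [keep_theory SS T0] is just [T0] read in the larger
    signature. *)
Lemma prime_theory_clauses (T0 : theory S) :
  interpreted_theory T0 ->
  prime_theory SS (T0 `|` clause_theory K) =
    keep_theory SS T0 `|` clause_theory (prime_clauses SS K).
Proof.
move=> intT0; rewrite /prime_theory image_setU; congr (_ `|` _).
  apply: eq_imagel => phi /intT0 phi0.
  by apply: rename_formula_agree; rewrite phi0.
rewrite /clause_theory /prime_clauses !image_comp; apply: eq_imagel => c _ /=.
exact: rename_clause_formula.
Qed.

End ThetaClosure.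

(** Negative literals are eliminated over [T u T'], so convexity must be available there: derived
    for universal [T], assumed otherwise. *)
Theorem theorem4 (S : signature) (C : Type) (T : theory S)
    (SS : set (usym S + C))
    (convT : convex T)
    (convTT' : universal_theory T \/ convex (doubled_theory SS T)) :
  (eq_interpolation (doubled_theory SS T) (@intersection_sharing (sig2 SS)) ->
   beth_definability SS T) /\
  (forall (T0 : theory S) (K : set (clause S)),
     interpreted_theory T0 ->
     T = T0 `|` clause_theory K ->
     prime_theory SS T =
       keep_theory SS T0 `|` clause_theory (prime_clauses SS K) /\
     (eq_interpolation (doubled_theory SS T)
        (Theta_sharing (doubled_clauses SS K)) ->
      beth_definability (ThetaC K SS) T)).
Proof.
have convD : convex (doubled_theory SS T).
  by case: convTT' => // uT; apply: convex_doubled.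
split=> [|T0 K intT0 TE]; first exact: beth_of_intersection_interpolation.
split; first by rewrite TE; apply: prime_theory_clauses.
apply: beth_of_interpolation convD => [phi|X Y XK YK g].
  by rewrite TE; apply: ThetaC_transfer.
exact: Theta_sharing_sub.
Qed.
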